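(* Let $N\ge 1$ be an integer, let $q=e^{2\pi i/N}$, and let $\alpha,\beta$ be real parameters with $|a_n|<1$ for all $n\ge 0$. Let $\psi_n(z;N)$, $n=0,1,2,\dots$, be the CMV Laurent polynomials associated to the sieved Jacobi orthogonal polynomials on the unit circle (with parameters $\alpha,\beta$). Define the operator $$L(N)=z\partial_z+\sum_{k=0}^{N-1}A_k(z;N)\,(R_k-\mathcal I),\qquad R_kf(z)=f(q^k/z),$$ where $\mathcal I$ is the identity and, if $N$ is even, $$A_k(z;N)=\sigma_k\,\frac{z^2}{q^k-z^2},\qquad \sigma_k=\alpha+\beta+1+(-1)^k(\alpha-\beta),$$ while, if $N$ is odd, $$A_k(z;N)=\frac{(\alpha+\beta+1)z^2+\rho_k(\alpha-\beta)z}{q^k-z^2},\qquad \rho_k=\begin{cases}q^{k/2}, & k\ \text{even},\\ q^{(k-N)/2}, & k\ \text{odd}.\end{cases}$$ Then for every $n\ge 0$ $$L(N)\,\psi_n(z;N)=\lambda_n(N)\,\psi_n(z;N),\qquad \lambda_n(N)=\begin{cases}-n/2, & n\ \text{even},\\ (n+1)/2+(\alpha+\beta+1)N, & n\ \text{odd}.\end{cases}$$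
   Context: Given real $\alpha,\beta$, put $$a_n=-\frac{\alpha+\frac12+(-1)^{n+1}(\beta+\frac12)}{n+\alpha+\beta+2},\qquad n=0,1,2,\dots,$$ and assume $|a_n|<1$ for all $n\ge0$ (equivalently $\alpha,\beta>-1$). The sieved Verblunsky parameters are, for $n\ge 0$, $a_n(N)=a_{k-1}$ if $n=Nk-1$ for an integer $k\ge1$, and $a_n(N)=0$ otherwise. The sieved Jacobi orthogonal polynomials on the unit circle $\Phi_n(z;N)$ are the monic polynomials defined by $\Phi_0(z;N)=1$ and $$\Phi_{n+1}(z;N)=z\,\Phi_n(z;N)-a_n(N)\,z^n\Phi_n(z^{-1};N),\qquad n\ge 0.$$ The associated CMV Laurent polynomials are $$\psi_{2n}(z;N)=z^n\Phi_{2n}(z^{-1};N),\qquad \psi_{2n+1}(z;N)=z^{-n}\Phi_{2n+1}(z;N),\qquad n\ge0.$$ Operators act on Laurent polynomials in $z$, and identities are understood as identities of rational functions of $z$. *)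

(* Defs.v *)
From HB Require Import structures.
From mathcomp Require Import all_boot all_order all_algebra.
From mathcomp Require Import complex ring lra.
From mathcomp Require Import reals trigo.

Set Implicit Arguments.
Unset Strict Implicit.
Unset Printing Implicit Defensive.

Import Order.TTheory GRing.Theory Num.Theory.
Local Open Scope ring_scope.
Local Open Scope quotient_scope.

Local Notation "x %:F" := (@FracField.tofrac _ x).

Section RationalFunctions.
Variable K : fieldType.

Definition ratfun := {fraction {poly K}}.

Definition ratC (c : K) : ratfun := (c%:P)%:F.
Definition ratX : ratfun := 'X%:F.

HB.instance Definition _ := GRing.RMorphism.copy ratC
  (@FracField.tofrac {poly K} \o polyC).

(* [repr f] is a chosen fraction n / d representing f; [ratderiv_frac] and
   [ratcomp_frac] below show that the choice is immaterial. *)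
Definition ratderiv (f : ratfun) : ratfun :=
  let n := \n_(repr f) in let d := \d_(repr f) in
  (n^`() * d - n * d^`())%:F / d%:F ^+ 2.

(* f(g(z)), where g must not be a pole of f. *)
Definition ratcomp (f g : ratfun) : ratfun :=
  (map_poly ratC \n_(repr f)).[g] / (map_poly ratC \d_(repr f)).[g].

Lemma frac_repr (p d : {poly K}) : d != 0 ->
  \n_(repr (p%:F / d%:F : ratfun)) * d = p * \d_(repr (p%:F / d%:F : ratfun)).
Proof.
move=> d0; set f := p%:F / d%:F : ratfun.
have E : f = \pi_(ratfun) (Ratio p d).
  rewrite /f /GRing.mul /= /GRing.inv /= !piE /FracField.mulf /FracField.invf.
  by rewrite !numden_Ratio ?oner_eq0 ?mulr1 ?mul1r.
have := FracField.equivf_l (Ratio p d).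
by rewrite -E !numden_Ratio // [in RHS]mulrC.
Qed.

Lemma ratderiv_frac (p d : {poly K}) : d != 0 ->
  ratderiv (p%:F / d%:F) = (p^`() * d - p * d^`())%:F / d%:F ^+ 2.
Proof.
move=> d0; rewrite /ratderiv; have := frac_repr p d0.
have := denom_ratioP (repr (p%:F / d%:F : ratfun)).
set a := \n_ _; set b := \d_ _ => b0 e.
have e' := congr1 (fun u => u^`()) e; rewrite /= !derivM in e'.
apply/eqP; rewrite eqr_div ?expf_neq0 ?tofrac_eq0 //.
rewrite -!tofracXn -!tofracM tofrac_eq; apply/eqP.
have -> : (a^`() * b - a * b^`()) * d ^+ 2
  = (a^`() * d + a * d^`()) * (b * d) - a * d * (b^`() * d + b * d^`()) by ring.
rewrite e' e; ring.
Qed.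

Definition rattrans (g : ratfun) :=
  forall p : {poly K}, p != 0 -> (map_poly ratC p).[g] != 0.

Lemma ratcomp_frac (p d : {poly K}) (g : ratfun) : rattrans g -> d != 0 ->
  ratcomp (p%:F / d%:F) g = (map_poly ratC p).[g] / (map_poly ratC d).[g].
Proof.
move=> gT d0; rewrite /ratcomp; have := frac_repr p d0.
have := denom_ratioP (repr (p%:F / d%:F : ratfun)).
set a := \n_ _; set b := \d_ _ => b0 e.
apply/eqP; rewrite eqr_div ?gT // -!hornerM -!rmorphM /=.
by rewrite e mulrC.
Qed.

Lemma ratcomp_poly (p : {poly K}) (g : ratfun) : rattrans g ->
  ratcomp p%:F g = (map_poly ratC p).[g].
Proof.
move=> gT; have := ratcomp_frac p gT (oner_neq0 _).
by rewrite tofrac1 divr1 rmorph1 hornerC divr1.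
Qed.

Lemma horner_recip (p : {poly K}) n c : (size p <= n.+1)%N ->
  ratX ^+ n * (map_poly ratC p).[ratC c / ratX]
    = (\poly_(i < n.+1) (p`_(n - i) * c ^+ (n - i)))%:F.
Proof.
move=> sp; have X0 : ratX != 0 by rewrite tofrac_eq0 polyX_eq0.
rewrite (horner_coef_wide _ (leq_trans (size_poly _ _) sp)) mulr_sumr.
rewrite [in RHS]poly_def (raddf_sum (@FracField.tofrac {poly K})) /= (reindex_inj rev_ord_inj) /=.
apply: eq_bigr => i _; have hi : (i <= n)%N by rewrite -ltnS.
rewrite subSS coef_map /= -mul_polyC tofracM tofracXn -/ratX.
rewrite polyCM tofracM rmorphXn /= tofracXn -/(ratC c) -/(ratC _).
rewrite expr_div_n -[in ratX ^+ n](subnK hi) exprD.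
have cancel (F : fieldType) (a b u v : F) :
  a != 0 -> a * b * (u * (v / a)) = u * v * b by move=> a0; field.
by apply: cancel; rewrite expf_neq0.
Qed.

Lemma rattrans_inv (c : K) : c != 0 -> rattrans (ratC c / ratX).
Proof.
move=> c0 p p0; have sp : (size p <= (size p).-1.+1)%N by exact: leqSpred.
apply: contraNneq p0 => e; have := horner_recip c sp.
rewrite e mulr0 => /esym/eqP; rewrite tofrac_eq0 => /eqP/polyP/(_ 0%N)/eqP.
by rewrite coef_poly /= subn0 coef0 mulf_eq0 expf_eq0 (negPf c0) andbF orbF
  lead_coef_eq0.
Qed.

End RationalFunctions.

Arguments ratX {K}.

Section Sieved.
Variables (R : realType) (N : nat) (alpha beta : R).
Local Notation C := R[i]%C.

(* The convention x / 0 = 0 is harmless here: see [verblunsky_lt1]. *)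
Definition verblunsky (n : nat) : R :=
  - (alpha + 2^-1 + (-1) ^+ n.+1 * (beta + 2^-1)) / (n%:R + alpha + beta + 2).

(* n = N k - 1 with k >= 1 means that N divides n + 1, with quotient k. *)
Definition sieved (n : nat) : R :=
  if (N %| n.+1)%N then verblunsky (n.+1 %/ N).-1 else 0.

Definition realC (x : R) : ratfun C := ratC x%:C%C.

Fixpoint Phi (n : nat) : ratfun C :=
  if n is m.+1 then
    ratX * Phi m - realC (sieved m) * ratX ^+ m * ratcomp (Phi m) ratX^-1
  else 1.

Definition psi (m : nat) : ratfun C :=
  let n := m./2 in
  if odd m then ratX ^- n * Phi n.*2.+1
  else ratX ^+ n * ratcomp (Phi n.*2) ratX^-1.

Definition qroot : C := (cos (2 * pi / N%:R) +i* sin (2 * pi / N%:R))%C.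

Definition opR (k : nat) (f : ratfun C) : ratfun C :=
  ratcomp f (ratC (qroot ^+ k) / ratX).

Definition sigma (k : nat) : R :=
  alpha + beta + 1 + (-1) ^+ k * (alpha - beta).

(* Used for N odd and k < N, where both halves are exact. *)
Definition rho (k : nat) : C :=
  if odd k then qroot ^- ((N - k)./2) else qroot ^+ k./2.

Definition coefA (k : nat) : ratfun C :=
  if odd N then
    (realC (alpha + beta + 1) * ratX ^+ 2
       + ratC (rho k) * realC (alpha - beta) * ratX)
    / (ratC (qroot ^+ k) - ratX ^+ 2)
  else realC (sigma k) * (ratX ^+ 2 / (ratC (qroot ^+ k) - ratX ^+ 2)).

Definition opL (f : ratfun C) : ratfun C :=
  ratX * ratderiv f + \sum_(0 <= k < N) coefA k * (opR k f - f).

Definition eigval (n : nat) : R :=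
  if odd n then n.+1%:R / 2 + (alpha + beta + 1) * N%:R else - (n%:R / 2).

Lemma verblunsky_lt1 :
  (forall n, `|verblunsky n| < 1) <-> (-1 < alpha /\ -1 < beta).
Proof.
have frac_lt1 (u v : R) : v != 0 -> (`|- u / v| < 1) = (`|u| < `|v|).
  by move=> v0; rewrite mulNr normrN normf_div ltr_pdivrMr ?normr_gt0 // mul1r.
split=> [h|[ha hb] n]; last first.
  have n0 : 0 <= n%:R :> R by [].
  rewrite /verblunsky frac_lt1; last by lra.
  rewrite [ltRHS]ger0_norm; last by lra.
  rewrite -signr_odd ltr_norml /=; case: n n0 => [|n] n0.
    by rewrite /= expr1; lra.
  have n1 : 1 <= n.+1%:R :> R by rewrite ler1n.
  by case: odd; rewrite /= ?expr1 ?expr0; lra.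
have h0 := h 0%N; have h1 := h 1%N; have h3 := h 3%N.
have [s1|s1] := eqVneq (alpha + beta) (-3).
  move: h3; rewrite /verblunsky -signr_odd /= expr0 frac_lt1; last by lra.
  by rewrite ler0_norm ?ger0_norm; lra.
have [s2|s2] := eqVneq (alpha + beta) (-2).
  move: h1; rewrite /verblunsky -signr_odd /= expr0 frac_lt1; last by lra.
  by rewrite ler0_norm ?ger0_norm; lra.
have s1' : 1 + alpha + beta + 2 != 0.
  by apply: contraNneq s1 => e; apply/eqP; lra.
have s2' : 0 + alpha + beta + 2 != 0.
  by apply: contraNneq s2 => e; apply/eqP; lra.
move: h0 h1; rewrite /verblunsky -(signr_odd _ 1) -(signr_odd _ 2) /= expr0 expr1 !frac_lt1 //.
rewrite !ltr_norml.
case: (ger0P (1 + _ + _ + _)) => ?; case: (ger0P (0 + _ + _ + _)) => ?;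
  move=> /andP[? ?] /andP[? ?]; split; lra.
Qed.

Lemma Phi_monic n : exists p : {poly C},
  [/\ Phi n = p%:F, p \is monic & size p = n.+1].
Proof.
have XT : rattrans (ratX^-1 : ratfun C).
  by have := rattrans_inv (oner_neq0 C); rewrite rmorph1 div1r.
elim: n => [|n [p [Ep mp sp]]] /=.
  by exists 1; rewrite tofrac1 monic1 size_poly1.
have sp' : (size p <= n.+1)%N by rewrite sp.
have := horner_recip 1 sp'; rewrite rmorph1 div1r => E.
set r := \poly_(i < n.+1) _ in E.
have sr : (size ((sieved n)%:C%C *: r) < size ('X * p)%R)%N.
  rewrite mulrC size_mulX ?monic_neq0 // sp ltnS.
  exact: leq_trans (size_scale_leq _ _) (size_poly _ _).
exists ('X * p - (sieved n)%:C%C *: r); split.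
- rewrite Ep (ratcomp_poly _ XT) -mulrA E tofracB tofracM.
  by rewrite -mul_polyC tofracM.
- by rewrite monicE lead_coefDl ?size_polyN // lead_coefM lead_coefX
    (monicP mp) mulr1.
- by rewrite size_polyDl ?size_polyN // mulrC size_mulX ?monic_neq0 // sp.
Qed.

End Sieved.

(* Main.v *)
(* Put w = z^N and let p_k be the monic polynomials with the unsieved parameters
   a_k and p_k^* their reversals. Then Phi_{Nk+j} = z^j p_k(w) for 0 <= j < N, so
   every psi_n is z^s p_k(w) or z^s p_k^*(w) with an integer s. The reflection R_i
   maps z^s u(w) to q^{is} z^{-s} u(1/w), and the sums over i of A_i q^{is} have a
   closed form by orthogonality of the powers of q. Thus the eigenvalue equation
   becomes a first-order equation for p_k and p_k^* in the variable w, which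
   follows by induction on k from the Szego recurrence. *)
Require Import Defs.
From mathcomp Require Import all_boot all_order all_algebra.
From mathcomp Require Import complex ring lra zify.
From mathcomp Require Import reals trigo.

Set Implicit Arguments.
Unset Strict Implicit.
Unset Printing Implicit Defensive.

Import Order.TTheory GRing.Theory Num.Theory.
Local Open Scope ring_scope.
Local Open Scope quotient_scope.

Local Notation "x %:F" := (@FracField.tofrac _ x).

(** * Substitution and differentiation of rational functions *)

Section RationalFunctionCalculus.
Variable K : fieldType.
Implicit Types (f g : ratfun K) (p u : {poly K}).

(** Keeping the polynomial apart from its argument lets the later identities be read in w = z^N and
    in 1/w alike. *)
Definition rateval p f : ratfun K := (map_poly (@ratC K) p).[f].

Lemma ratX_neq0 : ratX != 0 :> ratfun K.
Proof. by rewrite tofrac_eq0 polyX_eq0. Qed.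

Lemma ratX_exp_neq1 n : (0 < n)%N -> ratX ^+ n != 1 :> ratfun K.
Proof.
case: n => // n _; rewrite -tofracXn -tofrac1 tofrac_eq.
apply/eqP => /(congr1 (fun u : {poly K} => u`_0)).
by rewrite coefXn coef1 => /eqP; rewrite eq_sym oner_eq0.
Qed.

Lemma ratfunP f : exists p d : {poly K}, d != 0 /\ f = p%:F / d%:F.
Proof.
exists \n_(repr f), \d_(repr f); split; first exact: denom_ratioP.
have d0 := denom_ratioP (repr f).
rewrite -[LHS]reprK /GRing.mul /= /GRing.inv /= !piE /FracField.mulf /FracField.invf.
by rewrite !numden_Ratio ?oner_eq0 ?mulr1 ?mul1r // Ratio_numden.
Qed.

Lemma ratcompM f1 f2 g : rattrans g ->
  ratcomp (f1 * f2) g = ratcomp f1 g * ratcomp f2 g.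
Proof.
move=> gT; have [p1 [d1 [d10 ->]]] := ratfunP f1.
have [p2 [d2 [d20 ->]]] := ratfunP f2.
rewrite mulf_div -!tofracM !ratcomp_frac ?mulf_neq0 //.
by rewrite !rmorphM !hornerM mulf_div.
Qed.

Lemma ratderivM f1 f2 :
  ratderiv (f1 * f2) = ratderiv f1 * f2 + f1 * ratderiv f2.
Proof.
have [p1 [d1 [d10 ->]]] := ratfunP f1.
have [p2 [d2 [d20 ->]]] := ratfunP f2.
rewrite mulf_div -!tofracM !ratderiv_frac ?mulf_neq0 // !derivM.
rewrite !(tofracB, tofracD, tofracM).
have e (F : fieldType) (a b c d a' b' c' d' : F) : b != 0 -> d != 0 ->
  ((a' * c + a * c') * (b * d) - a * c * (b' * d + b * d')) / (b * d) ^+ 2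
  = (a' * b - a * b') / b ^+ 2 * (c / d) + a / b * ((c' * d - c * d') / d ^+ 2).
  by move=> b0 d0; field; rewrite b0 d0.
by apply: e; rewrite tofrac_eq0.
Qed.

Lemma ratderiv_poly p : ratderiv p%:F = (p^`())%:F.
Proof.
have := ratderiv_frac p (oner_neq0 _).
by rewrite tofrac1 !divr1 derivC mulr0 subr0 mulr1 expr1n divr1.
Qed.

Lemma ratcomp_Xz (s : int) g : rattrans g -> ratcomp (ratX ^ s) g = g ^ s.
Proof.
move=> gT; have h n : ratcomp (ratX ^+ n) g = g ^+ n.
  by rewrite /ratX -tofracXn ratcomp_poly // map_polyXn hornerXn.
case: s => n; first exact: h.
rewrite NegzE -!exprnN -div1r -tofrac1 /ratX -tofracXn ratcomp_frac //.
  by rewrite map_polyXn hornerXn rmorph1 hornerC div1r.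
by rewrite expf_neq0 ?polyX_eq0.
Qed.

Lemma ratderiv_Xz (s : int) : ratX * ratderiv (ratX ^ s) = s%:~R * ratX ^ s :> ratfun K.
Proof.
have h n : ratX * ratderiv (ratX ^+ n) = n%:R * ratX ^+ n :> ratfun K.
  rewrite {2 3}/ratX -tofracXn ratderiv_poly derivXn.
  case: n => [|n]; first by rewrite mulr0n tofrac0 mulr0 mul0r.
  by rewrite rmorphMn /= mulrnAr -tofracM -exprS mulr_natl.
case: s => n; first exact: h.
rewrite NegzE -exprnN; have X0 : ratX ^+ n.+1 != 0 :> ratfun K.
  by rewrite expf_neq0 ?ratX_neq0.
(* Negative exponents: differentiate the identity z^(n+1) z^(-n-1) = 1. *)
have := congr1 (fun f => ratX * ratderiv f) (mulfV X0).
rewrite ratderivM -tofrac1 ratderiv_poly derivC tofrac0 mulr0 mulrDr mulrA h.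
move=> /eqP; rewrite addr_eq0 mulfK // => /eqP e.
apply: (mulfI X0); rewrite mulrCA -[LHS]opprK -e rmorphN /= mulNr mulrN.
by rewrite mulrCA mulfV // mulr1.
Qed.

Lemma rateval_Xn p n : rateval p (ratX ^+ n) = (p \Po 'X^n)%:F.
Proof.
rewrite /rateval comp_polyE horner_coef size_map_poly rmorph_sum.
apply: eq_bigr => i _; rewrite coef_map /= -mul_polyC tofracM !tofracXn.
by rewrite -/ratX -exprM.
Qed.

Lemma ratcomp_rateval p n g : rattrans g ->
  ratcomp (rateval p (ratX ^+ n)) g = rateval p (g ^+ n).
Proof.
move=> gT; rewrite rateval_Xn ratcomp_poly // map_comp_poly horner_comp.
by rewrite map_polyXn hornerXn.
Qed.

(** Chain rule for the Euler operator: on functions of w = z^n, z d/dz acts as n w d/dw. *)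
Lemma ratderiv_rateval p n : ratX * ratderiv (rateval p (ratX ^+ n))
  = n%:R * (ratX ^+ n * rateval p^`() (ratX ^+ n)).
Proof.
rewrite !rateval_Xn ratderiv_poly deriv_comp derivXn tofracM.
case: n => [|n]; first by rewrite mulr0n tofrac0 mulr0 mulr0 mul0r.
rewrite rmorphMn /= tofracXn -/ratX -mulr_natl (exprS ratX).
by rewrite mulrCA [LHS]mulrC [X in X * _ = _]mulrCA -!mulrA.
Qed.

End RationalFunctionCalculus.

(** * The Szego recurrence for a polynomial and its reversal *)

Section Szego.
Variables (K : fieldType) (a : nat -> K).

(* The pair of [Phi_n] and its reversed polynomial [z^n Phi_n(1/z)]. *)
Fixpoint szego n : {poly K} * {poly K} :=
  if n is m.+1 then
    ('X * (szego m).1 - a m *: (szego m).2, (szego m).2 - a m *: ('X * (szego m).1))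
  else (1, 1).

Lemma rateval_szegoS n f :
  (rateval (szego n.+1).1 f = f * rateval (szego n).1 f - ratC (a n) * rateval (szego n).2 f)
  * (rateval (szego n.+1).2 f = rateval (szego n).2 f - ratC (a n) * (f * rateval (szego n).1 f)).
Proof.
by split; rewrite /rateval /= rmorphB /= map_polyZ rmorphM /= map_polyX !hornerE.
Qed.

Lemma rateval_szego0 f : (rateval (szego 0).1 f = 1) * (rateval (szego 0).2 f = 1).
Proof. by split; rewrite /rateval /= rmorph1 hornerC. Qed.

(** The recurrence is preserved by f -> 1/f combined with exchanging the two components, at the cost
    of one factor f per step. *)
Lemma rateval_szego_inv n f : f != 0 ->
  (rateval (szego n).1 f^-1 = rateval (szego n).2 f / f ^+ n)
  * (rateval (szego n).2 f^-1 = rateval (szego n).1 f / f ^+ n).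
Proof.
move=> f0; elim: n => [|n [IH1 IH2]]; first by rewrite !rateval_szego0 divr1.
rewrite !rateval_szegoS IH1 IH2 exprS.
move: (rateval _ _) (rateval _ _) (ratC _) (f ^+ n) (expf_neq0 n f0) => u v c y y0.
have e (F : fieldType) (x z u' v' c' : F) : x != 0 -> z != 0 ->
    (x^-1 * (u' / z) - c' * (v' / z) = (u' - c' * (x * v')) / (x * z))
  * (u' / z - c' * (x^-1 * (v' / z)) = (x * u' - c' * v') / (x * z)).
  by move=> x0 z0; split; field; rewrite x0 z0.
by split; [apply: (e _ _ _ _ _ _ f0 y0).1 | apply: (e _ _ _ _ _ _ f0 y0).2].
Qed.

End Szego.

(** * First-order equations for the unsieved polynomials *)

Section JacobiEquation.
Variables (K : fieldType) (a : nat -> K) (g d : K).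
(** The Jacobi parameters with the denominator cleared; [g] will be alpha + beta + 1 and [d] will be
    alpha - beta. *)
Hypothesis a_even : forall n, ~~ odd n -> a n * (g + n.+1%:R) = - d.
Hypothesis a_odd : forall n, odd n -> a n * (g + n.+1%:R) = - g.
Local Notation p n := (szego a n).1.
Local Notation ps n := (szego a n).2.

(* Each equation is the image of the other under [z -> 1/z]; the induction
   needs both. *)
Lemma jacobi_equation n :
  ((1 - 'X^2) * ('X * (p n)^`() - n%:R * p n)
     = (g%:P + d%:P * 'X) * p n
       - (g%:P * 'X^(odd n) + d%:P * 'X^(~~ odd n)) * ps n)
  /\ ((1 - 'X^2) * ('X * (ps n)^`())
     = (g%:P * 'X^2 + d%:P * 'X) * ps n
       - 'X * (g%:P * 'X^(~~ odd n) + d%:P * 'X^(odd n)) * p n).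
Proof.
elim: n => [|n [IH1 IH2]].
  by rewrite /= derivC expr0 expr1; split; ring.
have ha : (a n)%:P * (g%:P + n.+1%:R) = - (if odd n then g else d)%:P.
  rewrite -polyC_natr -polyCD -polyCM -polyCN; congr (_%:P).
  by case: ifP => h; [exact: a_odd | apply: a_even; rewrite h].
rewrite /= !(derivB, derivZ, derivM, derivX) -!mul_polyC !mul1r.
move: IH1 IH2 ha; rewrite -natr1.
set P := (szego a n).1; set Q := (szego a n).2; set A := (a n)%:P.
move: (P^`()) (Q^`()) (n%:R : {poly K}) => P' Q' m IH1 IH2 ha.
have hA : A * (m + 1) = - (if odd n then g else d)%:P - A * g%:P by rewrite -ha; ring.
split.
(* The recurrence is expanded so that both induction hypotheses appear and the index enters only
   through [A * (m + 1)], which [hA] rewrites without the index. One polynomial identity per parity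
   remains. *)
- transitivity ('X * ((1 - 'X^2) * ('X * P' - m * P)) - A * ((1 - 'X^2) * ('X * Q'))
    + A * (m + 1) * (1 - 'X^2) * Q); first by ring.
  by rewrite IH1 IH2 hA; case: (odd n); rewrite /= !expr0 !expr1; ring.
- transitivity ((1 - 'X^2) * ('X * Q') - A * 'X * ((1 - 'X^2) * ('X * P' - m * P))
    - A * (m + 1) * 'X * (1 - 'X^2) * P); first by ring.
  by rewrite IH1 IH2 hA; case: (odd n); rewrite /= !expr0 !expr1; ring.
Qed.

End JacobiEquation.

(** * Sums over roots of unity *)

(* Since [(q ^ i) ^ N = 1], [1 - x ^ N] is the geometric sum times [q ^ i - x],
   and summing over [i] picks out one power of [x]. *)
Lemma sum_root_frac (F : fieldType) (N : nat) (q x : F) (s c : int) (t : nat) :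
  N.-primitive_root q -> x ^+ N != 1 -> (t < N)%N -> s - 1 + N%:Z * c = t ->
  \sum_(0 <= i < N) (q ^+ i) ^ s / (q ^+ i - x) = N%:R * x ^+ t / (1 - x ^+ N).
Proof.
move=> qP xN tN est.
have qN := prim_expr_order qP.
have q0 : q != 0.
  apply: contraTneq tN => q0; move/eqP: qN; rewrite q0 expr0n.
  by case: (N) => // m; rewrite eq_sym oner_eq0.
have x1 : 1 - x ^+ N != 0 by rewrite subr_eq0 eq_sym.
have qi i : (q ^+ i) ^+ N = 1 by rewrite exprAC qN expr1n.
have qx i : q ^+ i - x != 0.
  by rewrite subr_eq0; apply: contraNneq xN => <-; rewrite qi.
(* Modulo N the exponent [s] is [t.+1], so a natural power can replace the integer one. *)
have qs i : (q ^+ i) ^ s = (q ^+ i) ^+ t.+1.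
  have q0i : q ^+ i != 0 by rewrite expf_neq0.
  have -> : s = t.+1%:Z + N%:Z * (- c) by lia.
  by rewrite expfzDr // -exprz_exp -(exprnP _ N) qi exp1rz mulr1.
apply: (mulIf x1); rewrite mulfVK // mulr_suml.
under eq_bigr => i _ do [rewrite qs -[X in X - x ^+ N](qi i) subrXX mulrA mulfVK // mulr_sumr].
(* The coefficient of x^l is the sum over i of q^(i(t + N - l)); only l = t gives a nonzero sum,
   namely N. *)
rewrite exchange_big /= (bigD1 (Ordinal tN)) //= [X in _ + X]big1 ?addr0.
  under eq_bigr => i _.
    rewrite /= mulrA -exprD (_ : (t.+1 + (N.-1 - t) = N)%N); last by lia.
    rewrite qi mul1r; over.
  by rewrite sumr_const_nat subn0 mulr_natl.
move=> l /negP lt; under eq_bigr => i _ do rewrite mulrA -exprD exprAC.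
rewrite -mulr_suml; set r := q ^+ _.
have r1 : r != 1.
  (* The exponent t + N - l lies strictly between 0 and 2N, so if N divides it, it equals N and l =
     t. *)
  rewrite -(prim_order_dvd qP); apply/negP => /dvdnP [b hb]; apply: lt; apply/eqP/val_inj => /=.
  case: b hb (ltn_ord l) => [|[|b]] /=; [lia | lia |].
  by rewrite !mulSn; have := leq0n (b * N); lia.
have : (r - 1) * \sum_(0 <= i < N) r ^+ i = 0.
  by rewrite big_mkord -subrX1 /r exprAC qN expr1n subrr.
by move/eqP; rewrite mulf_eq0 subr_eq0 (negPf r1) => /eqP ->; rewrite mul0r.
Qed.

Lemma qroot_exp (R : realType) N k : qroot R N ^+ k =
  (cos (k%:R * (2 * pi / N%:R)) +i* sin (k%:R * (2 * pi / N%:R)))%C :> R[i].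
Proof.
rewrite /qroot; set t := 2 * pi / N%:R.
elim: k => [|k IH]; first by rewrite expr0 mul0r cos0 sin0.
rewrite exprS IH -(natr1 k) mulrDl mul1r cosD sinD.
by apply/eqP; rewrite eq_complex /=; apply/andP; split; apply/eqP; ring.
Qed.

Lemma qroot_primitive (R : realType) N : (0 < N)%N -> N.-primitive_root (qroot R N).
Proof.
move=> N0; have N0R : 0 < N%:R :> R by rewrite ltr0n.
apply/andP; split=> //; apply/forallP => i; rewrite unity_rootE qroot_exp.
apply/eqP; have := ltn_ord i; rewrite leq_eqVlt => /orP [/eqP e|iN].
  rewrite e eqxx mulrCA mulfV ?(lt0r_neq0 N0R) // mulr1 mulr_natl cos2pi sin2pi.
  exact: eqxx.
(* For smaller exponents the real part is already different from 1: it is cos 2y = 1 - 2 sin^2 y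
   with 0 < y < pi. *)
rewrite (ltn_eqF iN); apply/negbTE; rewrite eq_complex /= negb_and; apply/orP; left.
set y := i.+1%:R * (pi / N%:R) : R.
have -> : i.+1%:R * (2 * pi / N%:R) = y *+ 2 by rewrite /y -mulr_natl; ring.
have y0 : 0 < y by rewrite /y mulr_gt0 ?ltr0n // divr_gt0 ?pi_gt0.
have ypi : y < pi.
  by rewrite /y mulrA ltr_pdivrMr // mulrC ltr_pM2l ?pi_gt0 // ltr_nat.
have s0 : 0 < sin y by apply: sin_gt0_pi; rewrite y0.
by rewrite cos_mulr2n cos2sin2; apply/negP => /eqP e; nra.
Qed.

(** * Reduction of the sieved polynomials to the variable w = z^N *)

Section SievedReduction.
Variables (R : realType) (N : nat) (alpha beta : R).
Hypothesis N_gt0 : (0 < N)%N.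
Local Notation C := R[i]%C.
Local Notation F := (ratfun C).
Local Notation a := (fun n => (verblunsky alpha beta n)%:C%C).
Local Notation p n := (szego a n).1.
Local Notation ps n := (szego a n).2.
Local Notation w := (ratX ^+ N : F).
Local Notation Q := (ratC (qroot R N)).

Lemma rattrans_Xinv : rattrans (ratX^-1 : F).
Proof. by have := rattrans_inv (oner_neq0 C); rewrite rmorph1 div1r. Qed.

(** Inside a block of length N the parameter is 0 and each step multiplies by z. The step to index
    N(k+1) has parameter a_k and is the unsieved recurrence in w. *)
Lemma Phi_sieved k j : (j < N)%N ->
  Phi N alpha beta (N * k + j) = ratX ^+ j * rateval (p k) w.
Proof.
have step k' : Phi N alpha beta (N * k') = rateval (p k') w ->
  forall i, (i < N)%N -> Phi N alpha beta (N * k' + i) = ratX ^+ i * rateval (p k') w.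
  move=> h; elim=> [|i IH] iN; first by rewrite addn0 mul1r.
  rewrite addnS /= IH ?(ltnW iN) // /sieved.
  rewrite -addnS dvdn_addr ?dvdn_mulr // gtnNdvd // /realC rmorph0.
  by rewrite mul0r mul0r subr0 mulrA -exprS.
move=> jN; apply: (step k _ j jN) => {j jN}; elim: k => [|k IH].
  by rewrite muln0 /= rateval_szego0.
have e : (N * k.+1 = (N * k + N.-1).+1)%N by rewrite mulnS; lia.
rewrite e /= step //; last by lia.
rewrite /sieved -e dvdn_mulr // mulKn // succnK rateval_szegoS.
rewrite ratcompM ?ratcomp_rateval; try exact: rattrans_Xinv.
rewrite (ratcomp_Xz N.-1 rattrans_Xinv).
rewrite !exprVn rateval_szego_inv ?expf_neq0 ?ratX_neq0 //.
rewrite [X in X - _]mulrA -exprS prednK //; congr (_ - _).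
rewrite /realC -mulrA; congr (_ * _).
rewrite exprD exprM -exprnP exprVn.
have gen (G : fieldType) (x y u : G) : x != 0 -> y != 0 -> x * y * (y^-1 * (u / x)) = u.
  by move=> x0 y0; field; rewrite x0 y0.
by apply: gen; rewrite !expf_neq0 ?ratX_neq0.
Qed.

Lemma psi_sieved_odd k j m : (j < N)%N -> (N * k + j = m.*2.+1)%N ->
  psi N alpha beta m.*2.+1 = ratX ^ (j%:Z - m%:Z) * rateval (p k) w.
Proof.
move=> jN e; rewrite /psi [odd _]/= odd_double [_./2]/= uphalf_double -e Phi_sieved //.
by rewrite mulrA expfzDr ?ratX_neq0 // [X in X * _ = _]mulrC exprnN.
Qed.

(** Reversal contributes w^(-k), and the total exponent m - j - Nk is -m because Nk + j = 2m. *)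
Lemma psi_sieved_even k j m : (j < N)%N -> (N * k + j = m.*2)%N ->
  psi N alpha beta m.*2 = ratX ^ (- m%:Z) * rateval (ps k) w.
Proof.
move=> jN e; rewrite /psi odd_double doubleK -e Phi_sieved //.
rewrite ratcompM ?ratcomp_rateval; try exact: rattrans_Xinv.
rewrite (ratcomp_Xz j rattrans_Xinv).
rewrite !exprVn rateval_szego_inv ?expf_neq0 ?ratX_neq0 //.
rewrite -exprnP exprVn -exprnN.
have eX : w ^+ k * ratX ^+ j = ratX ^+ m * ratX ^+ m.
  by rewrite -exprM -!exprD e addnn.
have gen (G : fieldType) (x y z u : G) : x != 0 -> y != 0 -> z != 0 ->
    x * y = z * z -> z * (y^-1 * (u / x)) = z^-1 * u.
  move=> x0 y0 z0 h; apply: (mulIf (mulf_neq0 x0 y0)); rewrite [in RHS]h.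
  by field; rewrite x0 y0 z0.
by apply: gen => //; rewrite !expf_neq0 ?ratX_neq0.
Qed.

Lemma qroot_neq0 : qroot R N != 0.
Proof.
apply: contraTneq N_gt0 => q0; move/eqP: (prim_expr_order (qroot_primitive R N_gt0)).
by rewrite q0 expr0n; case: (N) => // m; rewrite eq_sym oner_eq0.
Qed.

(** Every reflection sends w to 1/w because (q^i)^N = 1, so [i] survives only in a scalar factor. *)
Lemma opR_sieved i (s : int) (u : {poly C}) :
  opR N i (ratX ^ s * rateval u w) = (Q ^+ i) ^ s * ratX ^ (- s) * rateval u w^-1.
Proof.
have gT : rattrans (ratC (qroot R N ^+ i) / ratX) by apply: rattrans_inv; rewrite expf_neq0 ?qroot_neq0.
rewrite /opR ratcompM // ratcomp_Xz // ratcomp_rateval // rmorphXn /=.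
rewrite expfzMl exprz_inv; congr (_ * rateval u _).
by rewrite expr_div_n exprAC -rmorphXn (prim_expr_order (qroot_primitive R N_gt0))
  rmorph1 expr1n div1r.
Qed.

(** * The coefficients A_k and the action of L on z^s u(w) *)

Local Notation g := (realC (alpha + beta + 1)).
Local Notation d := (realC (alpha - beta)).

(* Both parities of [N] at once: [rho k] and [(-1) ^ k] are [q ^ (k * uphalf N)]. *)
Lemma coefA_unified i : (i < N)%N -> coefA N alpha beta i =
  (g * ratX ^+ 2 + d * ratX ^+ (N + 2 - (uphalf N).*2) * (Q ^+ i) ^+ uphalf N)
  / (Q ^+ i - ratX ^+ 2).
Proof.
move=> iN; have qP := qroot_primitive R N_gt0; have qN := prim_expr_order qP.
rewrite /coefA rmorphXn /=; case: ifP => oN; last first.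
  have hN : (uphalf N).*2 = N by rewrite uphalf_half oN -[RHS]odd_double_half oN.
  (* Its square is 1, and it is not 1 itself since 0 < N/2 < N. *)
  have qh : qroot R N ^+ uphalf N = -1.
    have : (qroot R N ^+ uphalf N) ^+ 2 == 1 by rewrite -exprM muln2 hN qN.
    rewrite sqrf_eq1 -(prim_order_dvd qP) => /orP [/dvdn_leq|/eqP //].
    by move: hN N_gt0; case: (uphalf N) => [<-//|h] hN _ /(_ isT); rewrite -{1}hN; lia.
  have -> : (N + 2 - (uphalf N).*2 = 2)%N by rewrite hN addKn.
  rewrite exprAC -(rmorphXn (@ratC _) (uphalf N)) qh.
  have -> : realC (sigma alpha beta i) = g + ratC (-1) ^+ i * d.
    by rewrite /sigma /realC !(rmorphD, rmorphM, rmorphXn, rmorphN, rmorph1).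
  have gen (G : fieldType) (u v x y z : G) :
    (u + z * v) * (x * y) = (u * x + v * x * z) * y by ring.
  exact: gen.
have hN : (uphalf N).*2 = N.+1 by rewrite uphalf_half oN -[in RHS](odd_double_half N) oN.
have -> : (N + 2 - (uphalf N).*2 = 1)%N by rewrite hN; lia.
have -> : ratC (rho R N i) = (Q ^+ i) ^+ uphalf N.
  rewrite -!rmorphXn /=; congr ratC; rewrite /rho -exprM.
  have [r Nr hr] : exists2 r, N = r.*2.+1 & uphalf N = r.+1.
    by exists N./2; [rewrite -[LHS]odd_double_half oN | rewrite uphalf_half oN].
  (* Exponents are compared modulo N = 2r + 1. For i = 2k + 1, (N - i)/2 + i(r + 1) = N(k + 1); for
     i = 2k, i(r + 1) = k + Nk. *)
  have := odd_double_half i; move: (i./2) => k; case: ifP => oi /= ik.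
    have e : ((N - i)./2 + i * uphalf N = N * k.+1)%N.
      have -> : ((N - i)./2 = r - k)%N by lia.
      by rewrite hr [in RHS]Nr -ik; have : (k <= r)%N by [lia]; lia.
    apply: (mulfI (expf_neq0 (N - i)./2 qroot_neq0)).
    by rewrite mulfV ?expf_neq0 ?qroot_neq0 // -exprD e exprM qN expr1n.
  have -> : (i * uphalf N = k + N * k)%N by rewrite hr [in RHS]Nr -ik; lia.
  by rewrite exprD exprM qN expr1n mulr1.
by rewrite expr1 mulrC [in RHS]mulrC -mulrA [_ * (d * _)]mulrC.
Qed.

(** The shifts [c1] and [c2] bring the two exponents into [0, N), as [sum_root_frac] requires. Since
    that sum is taken at x = z^2, they reappear doubled, as powers of w. *)
Lemma sum_coefA (s c1 c2 : int) :
  0 <= s - 1 + N%:Z * c1 < N%:Z ->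
  0 <= s + (uphalf N)%:Z - 1 + N%:Z * c2 < N%:Z ->
  \sum_(0 <= i < N) coefA N alpha beta i * (Q ^+ i) ^ s =
  N%:R * ratX ^ (s + s) * (g * w ^ (c1 + c1) + d * w ^ (c2 + c2 + 1)) / (1 - w ^+ 2).
Proof.
move=> h1 h2.
have [t1 e1 l1] : exists2 t1, s - 1 + N%:Z * c1 = Posz t1 & (t1 < N)%N.
  by case/andP: h1; case: (_ + _) => // t _; exists t.
have [t2 e2 l2] : exists2 t2, s + (uphalf N)%:Z - 1 + N%:Z * c2 = Posz t2 & (t2 < N)%N.
  by case/andP: h2; case: (_ + _ * c2) => // t _; exists t.
have QP : N.-primitive_root Q.
  by rewrite (fmorph_primitive_root (@ratC _)) qroot_primitive.
have xN : (ratX ^+ 2) ^+ N != 1 :> F.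
  by rewrite -exprM ratX_exp_neq1 // muln_gt0.
have s1 := sum_root_frac QP xN l1 e1.
have s2 := sum_root_frac QP xN l2 e2.
have Q0 i : Q ^+ i != 0 by apply: expf_neq0; rewrite tofrac_eq0 polyC_eq0 qroot_neq0.
transitivity (g * ratX ^+ 2 * (\sum_(0 <= i < N) (Q ^+ i) ^ s / (Q ^+ i - ratX ^+ 2)) +
  d * ratX ^+ (N + 2 - (uphalf N).*2) *
  (\sum_(0 <= i < N) (Q ^+ i) ^ (s + (uphalf N)%:Z) / (Q ^+ i - ratX ^+ 2))).
  rewrite !mulr_sumr -big_split /=; apply: eq_big_nat => i /andP [_ iN].
  rewrite (coefA_unified iN) (expfzDr s (uphalf N) (Q0 i)).
  have gen (G : fieldType) (u v x y z t c : G) :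
    (u * x + v * y * z) / c * t = u * x * (t / c) + v * y * (t * z / c).
    by ring.
  exact: gen.
have f1 : ratX ^+ 2 * (ratX ^+ 2) ^+ t1 = ratX ^ (s + s) * w ^ (c1 + c1) :> F.
  rewrite -exprM -exprD !exprnP exprz_exp -expfzDr ?ratX_neq0 //; congr (_ ^ _); lia.
(* The natural subtraction is exact, as twice [uphalf N] is at most N + 1, and [uphalf N] cancels
   from the exponent; the remaining N gives the extra factor w. *)
have f2 : ratX ^+ (N + 2 - (uphalf N).*2) * (ratX ^+ 2) ^+ t2
    = ratX ^ (s + s) * w ^ (c2 + c2 + 1) :> F.
  have := uphalf_half N; have := odd_double_half N; have := leq_b1 (odd N).
  rewrite -exprM -exprD !exprnP exprz_exp -expfzDr ?ratX_neq0 // => ? ? ?.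
  congr (_ ^ _); lia.
rewrite s1 s2 exprAC.
have gen (G : fieldType) (u v x y x' y' z c1' c2' n i : G) :
    x * x' = z * c1' -> y * y' = z * c2' ->
    u * x * (n * x' * i) + v * y * (n * y' * i) = n * z * (u * c1' + v * c2') * i.
  move=> e1' e2'; have -> : u * x * (n * x' * i) = u * n * i * (x * x') by ring.
  by rewrite e1'; have -> : v * y * (n * y' * i) = v * n * i * (y * y') by [ring]; rewrite e2'; ring.
exact: gen.
Qed.

Lemma opL_sieved (s c1 c2 : int) (u : {poly C}) :
  0 <= s - 1 + N%:Z * c1 < N%:Z ->
  0 <= s + (uphalf N)%:Z - 1 + N%:Z * c2 < N%:Z ->
  opL N alpha beta (ratX ^ s * rateval u w) =
  ratX ^ s * (s%:~R * rateval u w + N%:R * (w * rateval u^`() w)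
    + N%:R * (g * w ^ (c1 + c1) + d * w ^ (c2 + c2 + 1)) / (1 - w ^+ 2) * rateval u w^-1
    - N%:R * (g * w ^+ 2 + d * w) / (1 - w ^+ 2) * rateval u w).
Proof.
move=> h1 h2; rewrite /opL ratderivM mulrDr mulrA ratderiv_Xz.
rewrite [ratX * (_ * _)]mulrCA ratderiv_rateval.
(* The identity terms of L are the case s = 0, where the residues are N - 1 and [uphalf N] - 1,
   whence the shifts 1 and 0. *)
have h0 : 0 <= 0 - 1 + N%:Z * 1 < N%:Z by lia.
have h0' : 0 <= 0 + (uphalf N)%:Z - 1 + N%:Z * 0 < N%:Z.
  by have := uphalf_half N; have := odd_double_half N; lia.
have S0 := sum_coefA h0 h0'; have Ss := sum_coefA h1 h2.
transitivity (s%:~R * ratX ^ s * rateval u w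
  + ratX ^ s * (N%:R * (w * rateval u^`() w))
  + ((\sum_(0 <= i < N) coefA N alpha beta i * (Q ^+ i) ^ s)
       * (ratX ^ (- s) * rateval u w^-1)
    - (\sum_(0 <= i < N) coefA N alpha beta i * (Q ^+ i) ^ 0)
       * (ratX ^ s * rateval u w))).
  congr (_ + _); rewrite !mulr_suml -sumrB; apply: eq_bigr => i _.
  by rewrite opR_sieved expr0z mulr1 mulrBr !mulrA.
rewrite Ss S0 addr0 expr0z mulr1 expfzDr ?ratX_neq0 // -(invr_expz _ s).
have X0 : ratX ^ s != 0 :> F by rewrite expfz_neq0 ?ratX_neq0.
have gen (G : fieldType) (X s' u0 n w' u1 A i v B : G) : X != 0 ->
  s' * X * u0 + X * (n * (w' * u1)) + (n * (X * X) * A * i * (X^-1 * v) - n * B * i * (X * u0))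
  = X * (s' * u0 + n * (w' * u1) + n * A * i * v - n * B * i * u0).
  by move=> X0'; field.
have w2 : w ^ (1 + 1) = w ^+ 2 by [].
have w1 : w ^ (0 + 1) = w by [].
rewrite w2 w1; exact: gen.
Qed.

(** * The Jacobi parameters and the eigenvalue equation *)

Hypothesis a_lt1 : forall n, `|verblunsky alpha beta n| < 1.

(** The bound on the parameters gives alpha, beta > -1, so the denominator n + alpha + beta + 2 is
    positive and can be cleared. *)
Lemma verblunsky_mul n : verblunsky alpha beta n * (alpha + beta + 1 + n.+1%:R)
  = - (if odd n then alpha + beta + 1 else alpha - beta).
Proof.
have [ha hb] := (verblunsky_lt1 alpha beta).1 a_lt1.
have n0 : 0 <= n%:R :> R by [].
have e : alpha + beta + 1 + n.+1%:R = n%:R + alpha + beta + 2 by rewrite -[n.+1%:R]natr1; ring.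
rewrite /verblunsky e mulfVK; last by apply: lt0r_neq0; lra.
by rewrite -signr_odd /=; case: (odd n); rewrite /= ?expr0 ?expr1; field.
Qed.

Lemma rateval_jacobi n :
  ((1 - w ^+ 2) * (w * rateval (p n)^`() w - n%:R * rateval (p n) w)
     = (g + d * w) * rateval (p n) w
       - (g * w ^+ odd n + d * w ^+ ~~ odd n) * rateval (ps n) w)
  /\ ((1 - w ^+ 2) * (w * rateval (ps n)^`() w)
     = (g * w ^+ 2 + d * w) * rateval (ps n) w
       - w * (g * w ^+ (~~ odd n) + d * w ^+ odd n) * rateval (p n) w).
Proof.
have verb m : (verblunsky alpha beta m)%:C%C * ((alpha + beta + 1)%:C%C + m.+1%:R)
    = - (if odd m then alpha + beta + 1 else alpha - beta)%:C%C.
  by rewrite -(rmorph_nat (real_complex R)) -rmorphD -rmorphM -rmorphN verblunsky_mul.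
have [||e1 e2] := @jacobi_equation C a (alpha + beta + 1)%:C%C (alpha - beta)%:C%C _ _ n.
- by move=> m /negbTE om; rewrite verb om.
- by move=> m om; rewrite verb om.
have EM u v : rateval (u * v) w = rateval u w * rateval v w by rewrite /rateval rmorphM hornerM.
have EB u v : rateval (u - v) w = rateval u w - rateval v w by rewrite /rateval rmorphB hornerD hornerN.
have ED u v : rateval (u + v) w = rateval u w + rateval v w by rewrite /rateval rmorphD hornerD.
have EX m : rateval 'X^m w = w ^+ m by rewrite /rateval map_polyXn hornerXn.
have EX1 : rateval 'X w = w by rewrite /rateval map_polyX hornerX.
have EC c : rateval c%:P w = ratC c by rewrite /rateval map_polyC hornerC.
have En m : rateval m%:R w = m%:R by rewrite -polyC_natr EC rmorph_nat.
by split; [have := congr1 (fun u => rateval u w) e1 | have := congr1 (fun u => rateval u w) e2];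
  rewrite !(EM, EB, ED, EX, EX1, EC, En).
Qed.

(** The shifts are the ceiling and the floor of k/2. The resulting powers of w are then w^k times
    those multiplying the reversed polynomial in [rateval_jacobi]. *)
Lemma odd_index_bounds k j m : (j < N)%N -> (N * k + j = m.*2.+1)%N ->
  0 <= (j%:Z - m%:Z) - 1 + N%:Z * (k./2 + odd k)%:Z < N%:Z
  /\ 0 <= (j%:Z - m%:Z) + (uphalf N)%:Z - 1 + N%:Z * (k./2)%:Z < N%:Z.
Proof.
have := uphalf_half N; have := odd_double_half N; have := odd_double_half k.
move: (k./2) (N./2) (uphalf N) => l r h <-.
by rewrite mulnDr -doubleMr; case: (odd k); case: (odd N) => *; split; lia.
Qed.

(** Here the shifts are one more than the floor of k/2, and its ceiling; the powers of w carry the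
    common factor w^(k+1). *)
Lemma even_index_bounds k j m : (j < N)%N -> (N * k + j = m.*2)%N ->
  0 <= - m%:Z - 1 + N%:Z * (k./2.+1)%:Z < N%:Z
  /\ 0 <= - m%:Z + (uphalf N)%:Z - 1 + N%:Z * (k./2 + odd k)%:Z < N%:Z.
Proof.
have := uphalf_half N; have := odd_double_half N; have := odd_double_half k.
move: (k./2) (N./2) (uphalf N) => l r h <-.
by rewrite mulnDr -doubleMr; case: (odd k); case: (odd N) => *; split; lia.
Qed.

Lemma opL_psi n : opL N alpha beta (psi N alpha beta n)
  = realC (eigval N alpha beta n) * psi N alpha beta n.
Proof.
have [k [j [jN en]]] : exists k j, (j < N)%N /\ (N * k + j = n)%N.
  by exists (n %/ N)%N, (n %% N)%N; rewrite ltn_pmod // mulnC -divn_eq.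
have w0 : w != 0 by rewrite expf_neq0 ?ratX_neq0.
have w1 : 1 - w ^+ 2 != 0.
  by rewrite subr_eq0 eq_sym -exprM ratX_exp_neq1 // muln_gt0 N_gt0.
have wk := expf_neq0 k w0.
have [J1 J2] := rateval_jacobi k.
have kE := odd_double_half k.
have rC x y : realC (x + y) = realC x + realC y by rewrite /realC !rmorphD.
have rM x y : realC (x * y) = realC x * realC y by rewrite /realC !rmorphM.
have rN m : realC m%:R = m%:R by rewrite /realC !rmorph_nat.
have := odd_double_half n; case: (boolP (odd n)) => on /=; rewrite ?add1n ?add0n => nE.
- have nE' : (N * k + j = n./2.*2.+1)%N by rewrite nE.
  have [h1 h2] := odd_index_bounds jN nE'.
  rewrite -nE (psi_sieved_odd jN nE') (opL_sieved _ h1 h2) (rateval_szego_inv _ _ w0).1.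
  have -> : w ^ ((k./2 + odd k)%:Z + (k./2 + odd k)%:Z) = w ^+ k * w ^+ odd k.
    by rewrite -exprD (exprnP w); congr (_ ^ _); lia.
  have -> : w ^ (k./2%:Z + k./2%:Z + 1) = w ^+ k * w ^+ (~~ odd k).
    by rewrite -exprD (exprnP w); congr (_ ^ _); lia.
  (* With n = 2m + 1, (n + 1)/2 = m + 1 = (j - m) + Nk: the power of z gives j - m, and the term
     [n%:R * rateval (p n) w] of the Jacobi equation gives Nk. *)
  have -> : realC (eigval N alpha beta n./2.*2.+1)
      = (j%:Z - n./2%:Z)%:~R + N%:R * k%:R + g * N%:R.
    rewrite /eigval /= odd_double /= [LHS]rC rM rN.
    have -> : n./2.*2.+2%:R / 2 = (n./2.+1)%:R :> R.
      by rewrite -doubleS -muln2 natrM mulfK ?pnatr_eq0.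
    rewrite rN; congr (_ + _).
    have -> : n./2.+1%:R = ((j%:Z - n./2%:Z) + (N * k)%:Z)%:~R :> F.
      by rewrite -[LHS]/((n./2.+1)%:Z%:~R); congr (_%:~R); lia.
    by rewrite rmorphD /=; congr (_ + _); exact: (natrM _ N k).
  move: (rateval (p k)^`() w) (rateval (p k) w) (rateval (ps k) w) J1 => P1 P Ps.
  (* After multiplication by 1 - w^2 the Jacobi equation removes the derivative and the reflected
     term. What remains, (g + d w) - (g w^2 + d w) = g(1 - w^2), is the source of the shift g N in
     the eigenvalue. *)
  have gen (G : fieldType) (x y y2 s n' k' u v W b c E E1 Es : G) : y != 0 -> y2 != 0 -> y2 = 1 - W ^+ 2 ->
    y2 * (W * E1 - k' * E) = (u + v * W) * E - (u * b + v * c) * Es ->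
    x * (s * E + n' * (W * E1) + n' * (u * (y * b) + v * (y * c)) / y2 * (Es / y)
      - n' * (u * W ^+ 2 + v * W) / y2 * E) = (s + n' * k' + u * n') * (x * E).
    move=> y0 y20 y2E e; apply: (mulfI y20).
    have -> : y2 * (x * (s * E + n' * (W * E1) + n' * (u * (y * b) + v * (y * c)) / y2 * (Es / y)
      - n' * (u * W ^+ 2 + v * W) / y2 * E)) = x * (y2 * s * E + n' * (y2 * (W * E1 - k' * E)) + n' * y2 * k' * E
       + n' * (u * b + v * c) * Es - n' * (u * W ^+ 2 + v * W) * E) by field; rewrite y0 y20.
    by rewrite e y2E; ring.
  move=> J; exact: gen wk w1 (erefl _) J.
have nE' : (N * k + j = n./2.*2)%N by rewrite nE.
have [h1 h2] := even_index_bounds jN nE'.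
rewrite -nE (psi_sieved_even jN nE') (opL_sieved _ h1 h2) (rateval_szego_inv _ _ w0).2.
have -> : w ^ ((k./2.+1)%:Z + (k./2.+1)%:Z) = w ^+ k * (w * w ^+ (~~ odd k)).
  by rewrite -exprS -exprD (exprnP w); congr (_ ^ _); lia.
have -> : w ^ ((k./2 + odd k)%:Z + (k./2 + odd k)%:Z + 1) = w ^+ k * (w * w ^+ odd k).
  by rewrite -exprS -exprD (exprnP w); congr (_ ^ _); lia.
have -> : realC (eigval N alpha beta n./2.*2) = (- n./2%:Z)%:~R.
  rewrite /eigval odd_double -[n./2.*2]muln2 natrM mulfK ?pnatr_eq0 //.
  by rewrite /realC !rmorphN /= !rmorph_nat.
move: (rateval (ps k)^`() w) (rateval (p k) w) (rateval (ps k) w) J2 => P1 P Ps.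
(* For even n the coefficient g w^2 + d w cancels exactly, so the eigenvalue is just the exponent of
   z. *)
have gen (G : fieldType) (x y y2 s n' u v W b c E E1 Es : G) : y != 0 -> y2 != 0 ->
    y2 * (W * E1) = (u * W ^+ 2 + v * W) * E - W * (u * b + v * c) * Es ->
    x * (s * E + n' * (W * E1) + n' * (u * (y * (W * b)) + v * (y * (W * c))) / y2 * (Es / y)
      - n' * (u * W ^+ 2 + v * W) / y2 * E) = s * (x * E).
  move=> y0 y20 e; apply: (mulfI y20).
  have -> : y2 * (x * (s * E + n' * (W * E1) + n' * (u * (y * (W * b)) + v * (y * (W * c))) / y2 * (Es / y)
      - n' * (u * W ^+ 2 + v * W) / y2 * E)) = x * (y2 * s * E + n' * (y2 * (W * E1))
       + n' * W * (u * b + v * c) * Es - n' * (u * W ^+ 2 + v * W) * E) by field; rewrite y0 y20.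
  by rewrite e; ring.
move=> J; exact: gen wk w1 J.
Qed.

End SievedReduction.

Unset Implicit Arguments.

Theorem theorem5p4 (R : realType) (N : nat) (alpha beta : R)
    (N_ge1 : (1 <= N)%N)
    (a_lt1 : forall n : nat, `|verblunsky alpha beta n| < 1) (n : nat) :
  opL N alpha beta (psi N alpha beta n)
    = realC (eigval N alpha beta n) * psi N alpha beta n.
Proof. exact: opL_psi. Qed.
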